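(* Let $\Lambda$ be a locally convex, row-finite $k$-graph and let $R$ be a commutative ring with $1$. Suppose that $A$ is a $\mathbb Z^k$-graded $R$-algebra and that $\phi:\mathrm{KP}_R(\Lambda)\to A$ is a graded $R$-algebra homomorphism. If $\phi(rp_v)\neq 0$ for all $r\in R\setminus\{0\}$ and all $v\in\Lambda^0$, then $\phi$ is injective.
   Context: $\mathbb N=\{0,1,2,\dots\}$, $k\geq 1$ is an integer, $e_1,\dots,e_k$ is the standard basis of $\mathbb N^k$, and $\leq$ on $\mathbb N^k$ is coordinatewise. A $k$-graph is a countable category $\Lambda$ with a functor $d:\Lambda\to\mathbb N^k$ (degree) satisfying the factorisation property: if $d(\lambda)=m+n$ with $m,n\in\mathbb N^k$, there are unique $\mu,\nu\in\Lambda$ with $d(\mu)=m$, $d(\nu)=n$, $\lambda=\mu\nu$. Morphisms are called paths; the set $\Lambda^0$ of objects (vertices) is identified with the set of paths of degree $0$; $r,s:\Lambda\to\Lambda^0$ are the codomain (range) and domain (source) maps, so $\lambda\mu$ is defined iff $s(\lambda)=r(\mu)$. Write $\Lambda^n=d^{-1}(n)$, $\Lambda^{\neq0}=\Lambda\setminus\Lambda^0$, $v\Lambda=\{\lambda:r(\lambda)=v\}$, $v\Lambda^n=v\Lambda\cap\Lambda^n$. $\Lambda$ is row-finite if every $v\Lambda^n$ is finite. $\Lambda$ is locally convex if for all $v\in\Lambda^0$, $i\neq j$, $\lambda\in v\Lambda^{e_i}$, $\mu\in v\Lambda^{e_j}$, the sets $s(\lambda)\Lambda^{e_j}$ and $s(\mu)\Lambda^{e_i}$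 are nonempty. For $n\in\mathbb N^k$, $\Lambda^{\leq n}=\{\lambda\in\Lambda: d(\lambda)\leq n,\text{ and } d(\lambda)_i<n_i\text{ implies } s(\lambda)\Lambda^{e_i}=\emptyset\}$, and $v\Lambda^{\leq n}=v\Lambda\cap\Lambda^{\leq n}$. Kumjian-Pask families: for each $\lambda\in\Lambda^{\neq 0}$ let $\lambda^*$ be a formal symbol (ghost path), and let $G(\Lambda^{\neq0})=\{\lambda^*:\lambda\in\Lambda^{\neq0}\}$; for $v\in\Lambda^0$ put $v^*=v$. $R$-algebras are associative but need not be unital. A Kumjian-Pask $\Lambda$-family $(P,S)$ in an $R$-algebra $A$ consists of functions $P:\Lambda^0\to A$ and $S:\Lambda^{\neq0}\cup G(\Lambda^{\neq0})\to A$ such that, with the convention $S_v=S_{v^*}=P_v$ for $v\in\Lambda^0$: (KP1) $P_vP_w=\delta_{v,w}P_v$ for $v,w\in\Lambda^0$; (KP2) for $\lambda,\mu\in\Lambda^{\neq0}$ with $r(\mu)=s(\lambda)$: $S_\lambda S_\mu=S_{\lambda\mu}$, $S_{\mu^*}S_{\lambda^*}=S_{(\lambda\mu)^*}$, $P_{r(\lambda)}S_\lambda=S_\lambda=S_\lambda P_{s(\lambda)}$, $P_{s(\lambda)}S_{\lambda^*}=S_{\lambda^*}=S_{\lambda^*}P_{r(\lambda)}$ (the last two for all $\lambda\in\Lambda^{\ne0}$); (KP3$'$) for all $n\in\mathbb N^k\setminus\{0\}$ and $\lambda,\mu\in\Lambda^{\leq n}$: $S_{\lambda^*}S_\mu=\delta_{\lambda,\mu}P_{s(\lambda)}$;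 (KP4$'$) for all $v\in\Lambda^0$ and $n\in\mathbb N^k\setminus\{0\}$: $P_v=\sum_{\lambda\in v\Lambda^{\leq n}}S_\lambda S_{\lambda^*}$. $\mathrm{KP}_R(\Lambda)$ is the $R$-algebra generated by a universal Kumjian-Pask $\Lambda$-family $(p,s)$: every Kumjian-Pask $\Lambda$-family $(Q,T)$ in an $R$-algebra $A$ is the image of $(p,s)$ under a unique $R$-algebra homomorphism $\mathrm{KP}_R(\Lambda)\to A$. It is $\mathbb Z^k$-graded by $\mathrm{KP}_R(\Lambda)_n=\operatorname{span}_R\{s_\alpha s_{\beta^*}:d(\alpha)-d(\beta)=n\}$. A homomorphism $\phi$ is graded if $\phi(\mathrm{KP}_R(\Lambda)_n)\subseteq A_n$ for all $n\in\mathbb Z^k$. *)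

(* Defs.v *)
From HB Require Import structures.
From mathcomp Require Import all_boot all_order all_algebra.
From mathcomp Require Import boolp classical_sets functions cardinality fsbigop.

Set Implicit Arguments.
Unset Strict Implicit.
Unset Printing Implicit Defensive.

Import GRing.Theory.

Local Open Scope classical_set_scope.
Local Open Scope ring_scope.

(* Associative R-algebras that need not be unital; MathComp's lalgType and
   algType are unital. *)
HB.mixin Record Lmodule_isNuAlgebra (R : comPzRingType) A
    of GRing.Lmodule R A := {
  numul : A -> A -> A;
  numulA : associative numul;
  numulDl : left_distributive numul +%R;
  numulDr : right_distributive numul +%R;
  nuscalerAl : forall (c : R) (x y : A), c *: numul x y = numul (c *: x) y;
  nuscalerAr : forall (c : R) (x y : A), c *: numul x y = numul x (c *: y)
}.

#[short(type="nuAlgType")]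
HB.structure Definition NuAlgebra (R : comPzRingType) :=
  { A of GRing.Lmodule R A & Lmodule_isNuAlgebra R A }.

Notation "x ** y" := (numul x y) (at level 40, left associativity) : ring_scope.

Definition nu_alg_hom (R : comPzRingType) (A B : nuAlgType R) (f : A -> B) :
  Prop := linear f /\ {morph f : x y / x ** y >-> x ** y}.

Definition lspan (R : pzRingType) (V : lmodType R) (X : set V) : set V :=
  [set x | exists (n : nat) (c : 'I_n -> R) (u : 'I_n -> V),
     (forall i, X (u i)) /\ x = \sum_(i < n) c i *: u i].

Notation natk k := {ffun 'I_k -> nat}.
Notation intk k := {ffun 'I_k -> int}.

Definition unit_vec k (i : 'I_k) : natk k := [ffun j => nat_of_bool (j == i)].

Definition deg_sub k (m n : natk k) : intk k :=
  [ffun i => (m i)%:Z - (n i)%:Z].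

(* A category given by its objects and all its morphisms. Composition is a
   total function whose value on pairs with src l <> rng m is irrelevant: no
   axiom or later definition refers to it. By unique factorisation the paths of
   degree 0 are exactly the identities [idp v], so that Lambda^0 may be
   represented by the type of vertices. *)
Record kgraph (k : nat) := KGraph {
  vertex : countType;
  paths : countType;
  rng : paths -> vertex;
  src : paths -> vertex;
  idp : vertex -> paths;
  comp : paths -> paths -> paths;
  deg : paths -> natk k;
  rng_idp : forall v, rng (idp v) = v;
  src_idp : forall v, src (idp v) = v;
  rng_comp : forall l m, src l = rng m -> rng (comp l m) = rng l;
  src_comp : forall l m, src l = rng m -> src (comp l m) = src m;
  comp_idl : forall l, comp (idp (rng l)) l = l;
  comp_idr : forall l, comp l (idp (src l)) = l;
  compA : forall l m n, src l = rng m -> src m = rng n ->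
    comp l (comp m n) = comp (comp l m) n;
  deg_idp : forall v, deg (idp v) = 0;
  deg_comp : forall l m, src l = rng m -> deg (comp l m) = deg l + deg m;
  factorisation : forall l m n, deg l = m + n ->
    exists! mn : paths * paths,
      [/\ deg mn.1 = m, deg mn.2 = n, src mn.1 = rng mn.2
        & l = comp mn.1 mn.2]
}.

Arguments idp {k} L v : rename.

Section KGraphTheory.
Variables (k : nat) (L : kgraph k).

(* v Lambda^n *)
Definition paths_at (v : vertex L) (n : natk k) : set (paths L) :=
  [set l | rng l = v /\ deg l = n].

Definition row_finite : Prop := forall v n, finite_set (paths_at v n).

Definition locally_convex : Prop :=
  forall (v : vertex L) (i j : 'I_k) (l m : paths L), i != j ->
    paths_at v (unit_vec i) l -> paths_at v (unit_vec j) m ->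
    paths_at (src l) (unit_vec j) !=set0 /\
    paths_at (src m) (unit_vec i) !=set0.

(* Lambda^{<= n} *)
Definition paths_le (n : natk k) : set (paths L) :=
  [set l | (forall i, (deg l i <= n i)%N) /\
     (forall i, (deg l i < n i)%N -> paths_at (src l) (unit_vec i) = set0)].

Variable R : comPzRingType.

(* [kpS l] is S_l and [kpG l] is S_{l^*}; both are defined on all paths, and
   [kpS_idp], [kpG_idp] are the convention S_v = S_{v^*} = P_v. For a row-finite
   k-graph the index set in [kp4] is finite, so the sum is a genuine finite
   sum. *)
Record kp_family (A : nuAlgType R) := KPFamily {
  kpP : vertex L -> A;
  kpS : paths L -> A;
  kpG : paths L -> A;
  kpS_idp : forall v, kpS (idp L v) = kpP v;
  kpG_idp : forall v, kpG (idp L v) = kpP v;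
  kp1 : forall v w, kpP v ** kpP w = if v == w then kpP v else 0;
  kp2_comp : forall l m, deg l != 0 -> deg m != 0 -> src l = rng m ->
    kpS l ** kpS m = kpS (comp l m) /\ kpG m ** kpG l = kpG (comp l m);
  kp2_path : forall l, deg l != 0 ->
    kpP (rng l) ** kpS l = kpS l /\ kpS l ** kpP (src l) = kpS l;
  kp2_ghost : forall l, deg l != 0 ->
    kpP (src l) ** kpG l = kpG l /\ kpG l ** kpP (rng l) = kpG l;
  kp3 : forall (n : natk k) l m, n != 0 -> paths_le n l -> paths_le n m ->
    kpG l ** kpS m = if l == m then kpP (src l) else 0;
  kp4 : forall v (n : natk k), n != 0 ->
    kpP v = \sum_(l \in [set l | rng l = v] `&` paths_le n) kpS l ** kpG l
}.

(* The pair (KP, F) is the Kumjian-Pask algebra KP_R(Lambda) together with its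
   universal family (p, s). *)
Definition kp_universal (KP : nuAlgType R) (F : kp_family KP) : Prop :=
  forall (B : nuAlgType R) (Q : kp_family B),
    exists! f : KP -> B,
      [/\ nu_alg_hom f,
          forall v, f (kpP F v) = kpP Q v,
          forall l, f (kpS F l) = kpS Q l
        & forall l, f (kpG F l) = kpG Q l].

Definition kp_component (KP : nuAlgType R) (F : kp_family KP) (n : intk k) :
  set KP :=
  lspan [set x | exists a b : paths L,
    deg_sub (deg a) (deg b) = n /\ x = kpS F a ** kpG F b].

End KGraphTheory.

(* A is the internal direct sum of the R-submodules [gr n]. *)
Record is_grading k (R : comPzRingType) (A : nuAlgType R)
    (gr : intk k -> set A) : Prop := IsGrading {
  grading0 : forall n, gr n 0;
  gradingD : forall n x y, gr n x -> gr n y -> gr n (x + y);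
  gradingZ : forall n (c : R) x, gr n x -> gr n (c *: x);
  gradingM : forall m n x y, gr m x -> gr n y -> gr (m + n) (x ** y);
  grading_direct : forall a : A, exists! c : intk k -> A,
    [/\ forall n, gr n (c n), finite_set [set n | c n != 0]
      & a = \sum_(n \in [set: intk k]) c n]
}.

(* Main.v *)
(* By universality KP is spanned by the monomials S_a S_b^*, so by the grading
   of A it suffices to treat homogeneous x with phi x = 0. Given the degree n of
   x, choose N exceeding all the degrees d(b) that occur and put M = N + n.
   Inserting (KP4') between S_a and S_b^* rewrites x as a combination of
   monomials S_a S_b^* with a in Lambda^{<= M}, b in Lambda^{<= N} and
   s(a) = s(b). By (KP3') the compression S_a^* x S_b is c p_{s(a)}, where c is
   the coefficient of S_a S_b^* in x; it is killed by phi, hence c = 0. *)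
Require Import Defs.
From HB Require Import structures.
From mathcomp Require Import all_boot all_order all_algebra zify.
From mathcomp Require Import boolp classical_sets functions cardinality fsbigop.

Set Implicit Arguments.
Unset Strict Implicit.
Unset Printing Implicit Defensive.

Import GRing.Theory.

Local Open Scope classical_set_scope.
Local Open Scope ring_scope.

(** * Finite sums in non-unital algebras *)

Section NuAlgebraTheory.
Variables (R : comPzRingType) (A : nuAlgType R).
Implicit Types x y : A.

Lemma nu_mul0l x : 0 ** x = 0.
Proof. by apply: (addrI (0 ** x)); rewrite -numulDl !addr0. Qed.

Lemma nu_mul0r x : x ** 0 = 0.
Proof. by apply: (addrI (x ** 0)); rewrite -numulDr !addr0. Qed.

Lemma nu_mul_suml I (s : seq I) (P : pred I) (f : I -> A) x :
  (\sum_(i <- s | P i) f i) ** x = \sum_(i <- s | P i) f i ** x.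
Proof. exact: (big_morph (numul^~ x) (fun y z => numulDl y z x) (nu_mul0l x)). Qed.

Lemma nu_mul_sumr I (s : seq I) (P : pred I) (f : I -> A) x :
  x ** (\sum_(i <- s | P i) f i) = \sum_(i <- s | P i) x ** f i.
Proof. exact: (big_morph (numul x) (numulDr x) (nu_mul0r x)). Qed.

End NuAlgebraTheory.

(** * Linear spans *)

Section Span.
Variables (R : pzRingType) (V : lmodType R) (X : set V).

Lemma lspan_gen x : X x -> lspan X x.
Proof.
move=> Xx; exists 1%N, (fun=> 1), (fun=> x); split=> //.
by rewrite big_ord1 scale1r.
Qed.

Lemma lspan0 : lspan X 0.
Proof. by exists 0%N, (fun=> 0), (fun=> 0); split=> [[]//|]; rewrite big_ord0. Qed.

Lemma lspanD x y : lspan X x -> lspan X y -> lspan X (x + y).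
Proof.
move=> [m [c [u [Xu ->]]]] [n [d [v [Xv ->]]]].
pose glue T (f : 'I_m -> T) (g : 'I_n -> T) (i : 'I_(m + n)) :=
  match fintype.split i with inl j => f j | inr j => g j end.
exists (m + n)%N, (glue _ c d), (glue _ u v); split=> [i|].
  by rewrite /glue; case: (fintype.split i).
rewrite big_split_ord /=; congr (_ + _); apply: eq_bigr => i _; rewrite /glue.
  by have -> : fintype.split (lshift n i) = inl i by exact: (unsplitK (inl i)).
by have -> : fintype.split (rshift m i) = inr i by exact: (unsplitK (inr i)).
Qed.

Lemma lspan_sum I (s : seq I) (P : pred I) (f : I -> V) :
  (forall i, P i -> lspan X (f i)) -> lspan X (\sum_(i <- s | P i) f i).
Proof. by move=> Xf; apply: big_ind => //; [exact: lspan0 | exact: lspanD]. Qed.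

End Span.

Lemma lspanZ (R : comPzRingType) (V : lmodType R) (X : set V) (a : R) x :
  lspan X x -> lspan X (a *: x).
Proof.
move=> [n [c [u [Xu ->]]]]; exists n, (fun i => a * c i), u; split=> //.
by rewrite scaler_sumr; apply: eq_bigr => i _; rewrite scalerA.
Qed.

Lemma lspanM (R : comPzRingType) (A : nuAlgType R) (X Y Z : set A) x y :
  (forall a b, X a -> Y b -> lspan Z (a ** b)) ->
  lspan X x -> lspan Y y -> lspan Z (x ** y).
Proof.
move=> XYZ [m [c [u [Xu ->]]]] [n [d [v [Yv ->]]]].
rewrite nu_mul_suml; apply: lspan_sum => i _.
rewrite nu_mul_sumr; apply: lspan_sum => j _.
rewrite -nuscalerAl -nuscalerAr.
by apply: lspanZ; apply: lspanZ; apply: XYZ.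
Qed.

(** * A multiplicatively closed span as an algebra *)

Section Subalgebra.
Variables (R : comPzRingType) (A : nuAlgType R) (X : set A).
Hypothesis XM : forall x y, X x -> X y -> lspan X (x ** y).

Definition in_lspan : {pred A} := fun x => `[< lspan X x >].

Lemma in_lspan_submod : submod_closed in_lspan.
Proof.
split=> [|a x y /asboolP Xx /asboolP Xy]; apply/asboolP; first exact: lspan0.
by apply: lspanD => //; apply: lspanZ.
Qed.

HB.instance Definition _ :=
  GRing.isSubmodClosed.Build R A in_lspan in_lspan_submod.

(* The closure hypothesis is a parameter of the type so that the algebra
   structure below can depend on it. *)
Definition subalg (_ : forall x y, X x -> X y -> lspan X (x ** y)) : Type :=
  {x : A | in_lspan x}.

HB.instance Definition _ := SubChoice.on (subalg XM).
HB.instance Definition _ := [SubChoice_isSubLmodule of subalg XM by <:].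

Definition subalg_mk x (Xx : lspan X x) : subalg XM :=
  exist _ x (introT (asboolP _) Xx).

Lemma subalgP (x : subalg XM) : lspan X (\val x).
Proof. exact/asboolP/(valP x). Qed.

Definition subalg_mul (x y : subalg XM) : subalg XM :=
  subalg_mk (lspanM XM (subalgP x) (subalgP y)).

Fact subalg_mulA : associative subalg_mul.
Proof. by move=> x y z; apply: val_inj; apply: numulA. Qed.

Fact subalg_mulDl : left_distributive subalg_mul +%R.
Proof. by move=> x y z; apply: val_inj; apply: numulDl. Qed.

Fact subalg_mulDr : right_distributive subalg_mul +%R.
Proof. by move=> x y z; apply: val_inj; apply: numulDr. Qed.

Fact subalg_scaleAl (c : R) x y : c *: subalg_mul x y = subalg_mul (c *: x) y.
Proof. by apply: val_inj; apply: nuscalerAl. Qed.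

Fact subalg_scaleAr (c : R) x y : c *: subalg_mul x y = subalg_mul x (c *: y).
Proof. by apply: val_inj; apply: nuscalerAr. Qed.

HB.instance Definition _ := Lmodule_isNuAlgebra.Build R (subalg XM)
  subalg_mulA subalg_mulDl subalg_mulDr subalg_scaleAl subalg_scaleAr.

End Subalgebra.

(** * Paths of a k-graph *)

Section KPFamilies.
Local Notation comp := Defs.comp.
Variables (k : nat) (L : kgraph k).
Implicit Types (l m a b c d : paths L) (v w : vertex L) (M N n : natk k).

(** Prefixing [l] by [idp L (rng l)] and following it by [idp L (src l)] both factor [l] in degrees
    0 + 0, so uniqueness identifies the two factorisations. *)
Lemma deg0_idp l : deg l = 0 -> l = idp L (rng l).
Proof.
move=> l0; have l00 : deg l = 0 + 0 by rewrite addr0.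
have [[p q] [_ uniq_pq]] := factorisation l00.
have e1 : (p, q) = (idp L (rng l), l).
  by apply: uniq_pq; split=> //=; rewrite ?deg_idp ?src_idp ?comp_idl.
have e2 : (p, q) = (l, idp L (src l)).
  by apply: uniq_pq; split=> //=; rewrite ?deg_idp ?rng_idp ?comp_idr.
by move: e2; rewrite e1 => -[].
Qed.

(** Prefixing [b] shifts the degree and its bound alike and keeps the source, hence also the
    stopping condition. *)
Lemma paths_le_comp N n b l : src b = rng l -> N = deg b + n ->
  paths_le n l -> paths_le N (comp b l).
Proof.
move=> bl -> [le_n stop]; split=> i; rewrite deg_comp // !ffunE.
  by rewrite leq_add2l.
by rewrite ltn_add2l src_comp //; exact: stop.
Qed.

Lemma finite_natk_le n : finite_set [set m : natk k | forall i, (m i <= n i)%N].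
Proof.
(* A single bound for all coordinates of [n], so that [m] comes from a function into one finite
   ordinal. *)
pose B := (\sum_i n i)%N.
pose F (f : {ffun 'I_k -> 'I_B.+1}) : natk k := [ffun i => f i : nat].
apply: (@sub_finite_set _ _ (F @` setT)); last first.
  by apply: finite_image; exact: finite_finset.
move=> m mn; exists [ffun i => inord (m i)] => //.
apply/ffunP => i; rewrite !ffunE inordK // ltnS.
by apply: leq_trans (mn i) _; rewrite /B (bigD1 i) //= leq_addr.
Qed.

(** A union over the finitely many degrees below [n] of sets that are finite by row-finiteness. *)
Lemma finite_paths_le v n : row_finite L ->
  finite_set ([set l | rng l = v] `&` paths_le n).
Proof.
move=> fin; have := bigcup_finite (finite_natk_le n) (fun M _ => fin v M).
by apply: sub_finite_set => l [lv [le_n _]]; exists (deg l).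
Qed.

(** * Relations in a Kumjian-Pask family *)

Variables (R : comPzRingType) (A : nuAlgType R) (F : kp_family L A).
Local Notation P := (kpP F).
Local Notation S := (kpS F).
Local Notation G := (kpG F).

Lemma kpPS l : P (rng l) ** S l = S l.
Proof.
have [/deg0_idp->|/(kp2_path F)[]//] := eqVneq (deg l) 0.
by rewrite rng_idp kpS_idp kp1 eqxx.
Qed.

Lemma kpSP l : S l ** P (src l) = S l.
Proof.
have [/deg0_idp->|/(kp2_path F)[]//] := eqVneq (deg l) 0.
by rewrite src_idp kpS_idp kp1 eqxx.
Qed.

Lemma kpPG l : P (src l) ** G l = G l.
Proof.
have [/deg0_idp->|/(kp2_ghost F)[]//] := eqVneq (deg l) 0.
by rewrite src_idp kpG_idp kp1 eqxx.
Qed.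

Lemma kpGP l : G l ** P (rng l) = G l.
Proof.
have [/deg0_idp->|/(kp2_ghost F)[]//] := eqVneq (deg l) 0.
by rewrite rng_idp kpG_idp kp1 eqxx.
Qed.

(** Factors of degree 0 are vertex idempotents absorbed by their neighbour; non-composable factors
    meet in P_{s(l)} P_{r(m)} = 0. *)
Lemma kpSS l m : S l ** S m = if src l == rng m then S (comp l m) else 0.
Proof.
case: eqP => [lm|/eqP/negPf lm]; last first.
  by rewrite -kpSP -(kpPS m) -numulA (numulA (P _)) kp1 lm nu_mul0l nu_mul0r.
have [l0|l0] := eqVneq (deg l) 0.
  have ll := deg0_idp l0; move: lm; rewrite ll src_idp => ->.
  by rewrite kpS_idp kpPS comp_idl.
have [m0|m0] := eqVneq (deg m) 0; last by have [] := kp2_comp F l0 m0 lm.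
by rewrite (deg0_idp m0) -lm kpS_idp kpSP comp_idr.
Qed.

Lemma kpGG l m : G m ** G l = if src l == rng m then G (comp l m) else 0.
Proof.
case: eqP => [lm|/eqP/negPf lm]; last first.
  by rewrite -kpGP -(kpPG l) -numulA (numulA (P _)) kp1 eq_sym lm
    nu_mul0l nu_mul0r.
have [l0|l0] := eqVneq (deg l) 0.
  have ll := deg0_idp l0; move: lm; rewrite ll src_idp => ->.
  by rewrite kpG_idp kpGP comp_idl.
have [m0|m0] := eqVneq (deg m) 0; last by have [] := kp2_comp F l0 m0 lm.
by rewrite (deg0_idp m0) -lm kpG_idp kpPG comp_idr.
Qed.

Lemma kpSG_neq a b : src a != src b -> S a ** G b = 0.
Proof.
move=> /negPf ab.
by rewrite -kpSP -(kpPG b) -numulA (numulA (P _)) kp1 ab nu_mul0l nu_mul0r.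
Qed.

Hypothesis L_fin : row_finite L.

(** Indexing (KP4') by a list lets products distribute over the sum. *)
Lemma kp4_seq v n : n != 0 -> exists2 s : seq (paths L),
  forall l, l \in s -> rng l = v /\ paths_le n l &
  P v = \sum_(l <- s) S l ** G l.
Proof.
move=> n0; have fin := finite_paths_le v n L_fin.
exists (finmap.enum_fset (fset_set ([set l | rng l = v] `&` paths_le n))).
  by move=> l; rewrite in_fset_set // inE.
by rewrite (kp4 F v n0) fsbig_finite.
Qed.

Lemma kpS_expand a n : n != 0 -> exists2 s : seq (paths L),
  forall l, l \in s -> rng l = src a /\ paths_le n l &
  S a = \sum_(l <- s) S (comp a l) ** G l.
Proof.
move=> n0; have [s sP eP] := kp4_seq (src a) n0; exists s => //.
rewrite -{1}kpSP eP nu_mul_sumr !big_seq; apply: eq_bigr => l /sP[la _].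
by rewrite numulA kpSS la eqxx.
Qed.

Lemma kpG_expand b n : n != 0 -> exists2 s : seq (paths L),
  forall l, l \in s -> rng l = src b /\ paths_le n l &
  G b = \sum_(l <- s) S l ** G (comp b l).
Proof.
move=> n0; have [s sP eP] := kp4_seq (src b) n0; exists s => //.
rewrite -{1}kpPG eP nu_mul_suml !big_seq; apply: eq_bigr => l /sP[lb _].
by rewrite -numulA kpGG lb eqxx.
Qed.

(** * Spanning by monomials *)

Definition kp_monomials : set A := [set x | exists a b, x = S a ** G b].

(** Equality of the sources lets a compression end in a single vertex idempotent. *)
Definition kp_monomials_le M N : set A :=
  [set x | exists a b, [/\ paths_le M a, paths_le N b, src a = src b
     & x = S a ** G b]].

(** (KP4') inserted between S_a and S_b^* yields terms S_{al} S_{bl}^* with l in Lambda^{<= n}, so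
    both bounds move by the same [n]. *)
Lemma kp_monomial_le a b n : n != 0 ->
  lspan (kp_monomials_le (deg a + n) (deg b + n)) (S a ** G b).
Proof.
move=> n0; have [ab|/kpSG_neq->] := eqVneq (src a) (src b); last exact: lspan0.
have [s sP ->] := kpG_expand b n0; rewrite nu_mul_sumr big_seq.
apply: lspan_sum => l /sP[lb nl]; rewrite numulA kpSS lb ab eqxx.
apply: lspan_gen; exists (comp a l), (comp b l); split=> //.
- by apply: paths_le_comp nl; rewrite ?lb.
- by apply: paths_le_comp nl; rewrite ?lb.
- by rewrite !src_comp ?lb.
Qed.

Hypothesis k_gt0 : (0 < k)%N.

(** Here k > 0 enters: for k = 0 the zero degree would satisfy the hypothesis vacuously. *)
Lemma natk_neq0 n : (forall i, (0 < n i)%N) -> n != 0.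
Proof.
move=> n_gt0; apply/eqP => /ffunP/(_ (Ordinal k_gt0)); rewrite ffunE => e.
by have := n_gt0 (Ordinal k_gt0); rewrite e.
Qed.

(* Expanding S_b^* and S_c through paths in a common Lambda^{<= N} makes (KP3')
   applicable; the two shifts by 1 keep every degree nonzero, as (KP3') and
   (KP4') require. *)
Lemma kpGS_span b c : lspan kp_monomials (G b ** S c).
Proof.
have nz a : deg a + [ffun=> 1%N] != 0.
  by apply: natk_neq0 => i; rewrite !ffunE addrC.
have [s sP ->] := kpG_expand b (nz c).
have [t tP ->] := kpS_expand c (nz b).
rewrite nu_mul_suml big_seq; apply: lspan_sum => l /sP[lb nl].
rewrite nu_mul_sumr big_seq; apply: lspan_sum => m /tP[mc nm].
have nzN : deg b + (deg c + [ffun=> 1%N]) != 0.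
  by apply: natk_neq0 => i; rewrite !ffunE addrA addrC.
rewrite numulA -(numulA (S l)) (kp3 F nzN).
- case: eqP => _; last by rewrite nu_mul0r nu_mul0l; exact: lspan0.
  by rewrite src_comp // kpSP; apply: lspan_gen; exists l, m.
- exact: paths_le_comp nl.
- by apply: paths_le_comp nm; rewrite // addrCA.
Qed.

Lemma kp_monomialsM x y : kp_monomials x -> kp_monomials y ->
  lspan kp_monomials (x ** y).
Proof.
move=> [a [b ->]] [c [d ->]]; rewrite numulA -(numulA (S a)).
(* The inner product S_b^* S_c becomes a combination of terms S_p S_q^* whose paths then absorb [a]
   and [d]. *)
have [n [e [u [Xu ->]]]] := kpGS_span b c.
rewrite nu_mul_sumr nu_mul_suml; apply: lspan_sum => i _.
rewrite -nuscalerAr -nuscalerAl; apply: lspanZ.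
have [p [q ->]] := Xu i; rewrite numulA -numulA kpSS kpGG.
case: eqP => _; last by rewrite nu_mul0l; exact: lspan0.
case: eqP => _; last by rewrite nu_mul0r; exact: lspan0.
by apply: lspan_gen; exists (comp a p), (comp d q).
Qed.

Lemma kpS_monomial a : kp_monomials (S a).
Proof. by exists a, (idp L (src a)); rewrite kpG_idp kpSP. Qed.

Lemma kpG_monomial b : kp_monomials (G b).
Proof. by exists (idp L (src b)), b; rewrite kpS_idp kpPG. Qed.

Lemma kpP_monomial v : kp_monomials (P v).
Proof. by rewrite -kpS_idp; exact: kpS_monomial. Qed.

Let B : nuAlgType R := subalg kp_monomialsM.
Let mkB x (Xx : kp_monomials x) : B :=
  subalg_mk kp_monomialsM (lspan_gen Xx).
Let PB v := mkB (kpP_monomial v).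
Let SB l := mkB (kpS_monomial l).
Let GB l := mkB (kpG_monomial l).

(** Corestricts the family to the subalgebra spanned by the monomials, to which universality can
    then be applied; each relation is checked after the injective inclusion [\val]. *)
Lemma kp_family_span : exists Q : kp_family L B,
  [/\ forall v, \val (kpP Q v) = P v, forall l, \val (kpS Q l) = S l
    & forall l, \val (kpG Q l) = G l].
Proof.
have h1 v : SB (idp L v) = PB v by apply: val_inj; exact: kpS_idp.
have h2 v : GB (idp L v) = PB v by apply: val_inj; exact: kpG_idp.
have h3 v w : PB v ** PB w = if v == w then PB v else 0.
  by apply: val_inj; rewrite (fun_if \val); exact: kp1.
have h4 l m : deg l != 0 -> deg m != 0 -> src l = rng m ->
    SB l ** SB m = SB (comp l m) /\ GB m ** GB l = GB (comp l m).
  move=> l0 m0 lm; have [e1 e2] := kp2_comp F l0 m0 lm.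
  by split; apply: val_inj.
have h5 l : deg l != 0 -> PB (rng l) ** SB l = SB l /\ SB l ** PB (src l) = SB l.
  by move=> _; split; apply: val_inj; [exact: kpPS | exact: kpSP].
have h6 l : deg l != 0 -> PB (src l) ** GB l = GB l /\ GB l ** PB (rng l) = GB l.
  by move=> _; split; apply: val_inj; [exact: kpPG | exact: kpGP].
have h7 n l m : n != 0 -> paths_le n l -> paths_le n m ->
    GB l ** SB m = if l == m then PB (src l) else 0.
  move=> n0 nl nm; apply: val_inj; rewrite (fun_if \val); exact: (kp3 F n0).
have h8 v n : n != 0 ->
    PB v = \sum_(l \in [set l | rng l = v] `&` paths_le n) SB l ** GB l.
  move=> n0; apply: val_inj.
  have fin := finite_paths_le v n L_fin.
  by rewrite fsbig_finite // raddf_sum /= (kp4 F v n0) fsbig_finite.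
by exists (KPFamily h1 h2 h3 h4 h5 h6 h7 h8).
Qed.

(** The universal map into the span, followed by the inclusion, fixes the generators; by uniqueness
    it is the identity, so every element lies in the span. *)
Lemma kp_universal_span : kp_universal F -> forall x, lspan kp_monomials x.
Proof.
move=> univ x; have [Q [QP QS QG]] := kp_family_span.
have [f [[[f_lin f_mul] fP fS fG] _]] := univ B Q.
have [g [_ g_uniq]] := univ A F.
have <- : \val (f x) = x; last exact: subalgP.
have -> : \val (f x) = g x.
  rewrite (g_uniq (\val \o f)) //; split=> [|v|l|l] /=.
  - split=> [e y z|y z] /=; first by rewrite f_lin.
    by rewrite f_mul.
  - by rewrite fP QP.
  - by rewrite fS QS.
  - by rewrite fG QG.
by rewrite (g_uniq idfun).
Qed.

End KPFamilies.

(** * Regrouping sums and shifting degrees *)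

Lemma partition_sum_codom (I : finType) (T : eqType) (V : nmodType)
    (p : I -> T) (f : I -> V) :
  \sum_i f i = \sum_(t <- undup (codom p)) \sum_(i | p i == t) f i.
Proof.
rewrite (exchange_big_dep xpredT) //=; apply: eq_bigr => i _.
rewrite (eq_bigl (pred1 (p i))) => [|t]; last exact: eq_sym.
rewrite -big_filter filter_pred1_uniq ?undup_uniq ?mem_undup ?codom_f //.
by rewrite big_seq1.
Qed.

Lemma deg_shift k (d : intk k) (p : natk k) : exists M N : natk k,
  [/\ forall i, (0 < M i)%N, forall i, (p i < N i)%N & deg_sub M N = d].
Proof.
(* [N] is p + |d| + 1 and [M] is N + d, which is at least 1, so the outer [absz] only casts it to a
   natural number. *)
exists [ffun i => absz ((p i)%:Z + (absz (d i))%:Z + 1 + d i)],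
  [ffun i => (p i + absz (d i) + 1)%N].
by split=> [i|i|]; [| |apply/ffunP => i]; rewrite !ffunE; move: (d i) (p i) => a b; lia.
Qed.

Lemma deg_sub_shift k (M N m n : natk k) : (forall i, (n i < N i)%N) ->
  deg_sub m n = deg_sub M N ->
  exists r : natk k, [/\ forall i, (0 < r i)%N, M = m + r & N = n + r].
Proof.
(* The truncated subtraction is exact since n < N, and equal differences give M - m = N - n. *)
move=> nN /ffunP e; exists [ffun i => (N i - n i)%N].
split=> [i||]; [|apply/ffunP => i..];
  have := e i; have := nN i; rewrite !ffunE; move: (M i) (N i) (m i) (n i) => ????; lia.
Qed.

(** * The kernel of a graded homomorphism *)

Section GradedUniqueness.
Variables (k : nat) (k_gt0 : (0 < k)%N) (L : kgraph k) (L_fin : row_finite L).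
Variables (R : comPzRingType) (KP A : nuAlgType R) (F : kp_family L KP).
Variables (phi : KP -> A) (phi_hom : nu_alg_hom phi).
Hypothesis phi_vertex :
  forall (r : R) (v : vertex L), r != 0 -> phi (r *: kpP F v) != 0.

Let phi0 : phi 0 = 0.
Proof.
by apply: (addrI (phi 0)); have := phi_hom.1 1 0 0; rewrite !scale1r !addr0.
Qed.

Let phiD x y : phi (x + y) = phi x + phi y.
Proof. by have := phi_hom.1 1 x y; rewrite !scale1r. Qed.

Let phi_sum I (s : seq I) (Q : pred I) (f : I -> KP) :
  phi (\sum_(i <- s | Q i) f i) = \sum_(i <- s | Q i) phi (f i).
Proof. exact: (big_morph phi phiD phi0). Qed.

(* The compression S_a^* x S_b isolates the coefficient of S_a S_b^* in x. *)
Lemma kp_le_kernel M N x : M != 0 -> N != 0 ->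
  lspan (kp_monomials_le F M N) x -> phi x = 0 -> x = 0.
Proof.
move=> M0 N0 [n [c [u [Xu xE]]]] phix0.
have /choice[q qP] : forall i, exists t : paths L * paths L,
    [/\ paths_le M t.1, paths_le N t.2, src t.1 = src t.2
      & u i = kpS F t.1 ** kpG F t.2].
  by move=> i; have [a [b ?]] := Xu i; exists (a, b).
(* Several indices may carry the same pair of paths, and the compression sees only their total
   coefficient. *)
pose C (t : paths L * paths L) := \sum_(j | q j == t) c j.
have xC : x = \sum_(t <- undup (codom q)) C t *: (kpS F t.1 ** kpG F t.2).
  rewrite xE (partition_sum_codom q); apply: eq_bigr => t _.
  rewrite scaler_suml; apply: eq_bigr => j /eqP <-.
  by have [_ _ _ ->] := qP j.
have compress i :
    kpG F (q i).1 ** x ** kpS F (q i).2 = C (q i) *: kpP F (src (q i).1).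
  have [Mi Ni ab _] := qP i.
  rewrite xE nu_mul_sumr nu_mul_suml scaler_suml [RHS]big_mkcond /=.
  apply: eq_bigr => j _; have [Mj Nj abj ->] := qP j.
  (* (KP3') at [M] on the left and at [N] on the right kills every [j] with [q j] different from
     [q i]. *)
  rewrite -nuscalerAr -nuscalerAl numulA (kp3 F M0) // -numulA (kp3 F N0) //.
  rewrite [q j == q i]xpair_eqE; rewrite [(q j).1 == _]eq_sym.
  case: eqP => _ /=; last by rewrite nu_mul0l scaler0.
  case: eqP => [->|_]; last by rewrite nu_mul0r scaler0.
  by rewrite -ab kp1 eqxx.
rewrite xC big_seq big1 // => t; rewrite mem_undup => /codomP[i ->].
have [->|/(@phi_vertex _ (src (q i).1))/eqP[]] := eqVneq (C (q i)) 0.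
  by rewrite scale0r.
by rewrite -compress !phi_hom.2 phix0 nu_mul0r nu_mul0l.
Qed.

Lemma kp_homogeneous_kernel n x : kp_component F n x -> phi x = 0 -> x = 0.
Proof.
move=> [m [c [u [Xu ->]]]].
have /choice[q qP] : forall i, exists t : paths L * paths L,
    deg_sub (deg t.1) (deg t.2) = n /\ u i = kpS F t.1 ** kpG F t.2.
  by move=> i; have [a [b ?]] := Xu i; exists (a, b).
(* The sum of all the d(b) dominates each of them, so [N] exceeds every d(b). *)
have [M [N [M0 leN MN]]] := deg_shift n (\sum_i deg (q i).2).
apply: (@kp_le_kernel M N); try apply: (natk_neq0 k_gt0) => // i.
  exact: leq_ltn_trans (leN i).
apply: lspan_sum => i _; apply: lspanZ; have [qn ->] := qP i.
have leNi j : (deg (q i).2 j < N j)%N.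
  apply: leq_ltn_trans (leN j).
  by rewrite sum_ffunE (bigD1 i) //= leq_addr.
(* Since d(a) - d(b) = n = M - N, the shift taking d(b) to [N] also takes d(a) to [M]. *)
have [r [r0 -> ->]] := deg_sub_shift leNi (etrans qn (esym MN)).
by apply: kp_monomial_le => //; exact: natk_neq0.
Qed.

Hypothesis F_universal : kp_universal F.
Variables (gr : intk k -> set A) (gr_grading : is_grading gr).
Hypothesis phi_graded : forall n, phi @` kp_component F n `<=` gr n.

Lemma kp_graded_kernel x : phi x = 0 -> x = 0.
Proof.
have [m [c [u [Xu ->]]]] := kp_universal_span L_fin k_gt0 F_universal x.
have /choice[q qP] : forall i, exists t : paths L * paths L,
    u i = kpS F t.1 ** kpG F t.2.
  by move=> i; have [a [b ?]] := Xu i; exists (a, b).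
pose d i := deg_sub (deg (q i).1) (deg (q i).2).
pose h (n : intk k) := \sum_(i | d i == n) c i *: u i.
have h_comp n : kp_component F n (h n).
  apply: lspan_sum => i /eqP <-; apply: lspanZ; apply: lspan_gen.
  by exists (q i).1, (q i).2.
have h_supp n : n \notin undup (codom d) -> h n = 0.
  rewrite mem_undup => nd; rewrite /h big_pred0 // => i.
  by apply: contraNF nd => /eqP <-; exact: codom_f.
rewrite (partition_sum_codom d) -/h phi_sum => phi_h.
(* Both the zero function and [phi \o h] are homogeneous decompositions of 0 in [A], so they
   coincide. *)
have [z [_ z_uniq]] := grading_direct gr_grading 0.
have z0 : z = fun=> 0.
  apply: z_uniq; split=> [n||].
  - exact: grading0 gr_grading _.
  - by apply: (sub_finite_set _ (finite_set0 _)) => n /=; rewrite eqxx.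
  - by rewrite fsbig1.
have zh : z = phi \o h.
  apply: z_uniq; split=> [n||].
  - by apply: phi_graded; exists (h n).
  - apply: sub_finite_set (finite_seq (undup (codom d))) => n /=.
    by apply: contraR => /h_supp ->; rewrite phi0.
  (* As [h] vanishes off the listed degrees, the sum over all degrees is the sum over the list. *)
  - rewrite (fsbigE _ _ (undup_uniq (codom d))) => [|//|n _ /h_supp /= ->//].
    by rewrite -[LHS]phi_h; apply: eq_bigl => n; rewrite in_setT.
have phih0 n : phi (h n) = 0 by rewrite -[LHS]/((phi \o h) n) -zh z0.
by rewrite big1 // => n _; exact: kp_homogeneous_kernel (h_comp n) (phih0 n).
Qed.

End GradedUniqueness.

Theorem theorem4p1 (k : nat) (k_gt0 : (0 < k)%N) (L : kgraph k)
    (L_convex : locally_convex L) (L_row_finite : row_finite L)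
    (R : comPzRingType)
    (KP : nuAlgType R) (F : kp_family L KP) (F_universal : kp_universal F)
    (A : nuAlgType R) (gr : intk k -> set A) (gr_grading : is_grading gr)
    (phi : KP -> A) (phi_hom : nu_alg_hom phi)
    (phi_graded : forall n, phi @` kp_component F n `<=` gr n) :
  (forall (r : R) (v : vertex L), r != 0 -> phi (r *: kpP F v) != 0) ->
  injective phi.
Proof.
move=> phi_vertex x y phi_xy; apply/eqP; rewrite -subr_eq0; apply/eqP.
apply: (kp_graded_kernel k_gt0 L_row_finite phi_hom phi_vertex F_universal
  gr_grading phi_graded).
(* [linear] speaks of c x + y, so x - y is read as (-1) y + x. *)
by rewrite addrC -scaleN1r phi_hom.1 phi_xy scaleN1r addNr.
Qed.
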